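(* Let $n\ge 1$. An algebraic subset of $\mathbb R^n$ is of type A if and only if it is of type B.
   Context: For $P\in\mathbb R[X_1,\ldots,X_n]$, let $\mathcal Z_P=\{x\in\mathbb R^n: P(x)=0\}$ and let $(P)$ be the ideal of $\mathbb R[X_1,\ldots,X_n]$ generated by $P$. For $Z\subset\mathbb R^n$, let $\mathcal I(Z)=\{R\in\mathbb R[X_1,\ldots,X_n]: R(x)=0\text{ for every }x\in Z\}$. An algebraic subset of $\mathbb R^n$ is the set of common zeros in $\mathbb R^n$ of all polynomials in an ideal of $\mathbb R[X_1,\ldots,X_n]$; equivalently it is a set of the form $V=\mathcal Z_P$ with $P\in\mathbb R[X_1,\ldots,X_n]$, in which case $V$ is said to be induced by $P$. A linear functional $\Lambda:\mathbb R[X_1,\ldots,X_n]\to\mathbb R$ is positive definite if $\Lambda(R^2)\ge 0$ for every $R$. It is a moment functional if there is a positive Borel measure $\mu$ on $\mathbb R^n$, with respect to which all polynomials are absolutely integrable, such that $\Lambda(R)=\int_{\mathbb R^n}R\,d\mu$ for all $R\in\mathbb R[X_1,\ldots,X_n]$. A polynomial $P\in\mathbb R[X_1,\ldots,X_n]$ is of type A (respectively, type B) if every positive definite linear functional $\Lambda:\mathbb R[X_1,\ldots,X_n]\to\mathbb R$ vanishing on $(P)$ (respectively, on $\mathcal I(\mathcal Z_P)$) is a moment functional. An algebraic set $V\subset\mathbb R^n$ induced by $P\in\mathbb R[X_1,\ldots,X_n]$ is of type A (respectively, type B) if $P$ is of type A (respectively, type B); these properties do not depend on the choice of the polynomial $P$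 inducing $V$. *)

(* Defs.v *)
From HB Require Import structures.
From mathcomp Require Import all_boot all_order all_algebra.
From mathcomp Require Import all_classical all_reals all_analysis.
From mathcomp Require mpoly.
(* The notations of mpoly clash with those of mathcomp-analysis. *)
Import -(notations) mpoly.

Set Implicit Arguments.
Unset Strict Implicit.
Unset Printing Implicit Defensive.

Import Order.TTheory GRing.Theory Num.Theory.
Import numFieldNormedType.Exports.

Local Open Scope classical_set_scope.
Local Open Scope ring_scope.

Section Defs.
Context {R : realType} {n : nat}.
Implicit Types (P Q S : mpoly n R) (I : set (mpoly n R)).
Implicit Types (V : set 'rV[R]_n) (L : {scalar mpoly n R}).

Definition peval P (x : 'rV[R]_n) : R := meval (fun i => x ord0 i) P.

Definition zero_set P : set 'rV[R]_n := [set x | peval P x = 0].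

(* Ideals are not required to be proper, so that the empty set is algebraic. *)
Definition is_ideal I : Prop :=
  [/\ I 0,
      forall P Q, I P -> I Q -> I (P + Q) &
      forall P Q, I Q -> I (P * Q)].

Definition principal_ideal P : set (mpoly n R) :=
  [set Q | exists S, Q = S * P].

Definition vanishing_ideal V : set (mpoly n R) :=
  [set Q | forall x, V x -> peval Q x = 0].

Definition common_zeros I : set 'rV[R]_n :=
  [set x | forall P, I P -> peval P x = 0].

Definition algebraic_set V : Prop :=
  exists I, is_ideal I /\ V = common_zeros I.

Definition induced_by V P : Prop := V = zero_set P.

Definition positive_definite L : Prop := forall P, 0 <= L (P ^+ 2).

(* R^n with its Borel sigma-algebra, generated by the open sets. *)
Definition borel_space := g_sigma_algebraType (@open 'rV[R]_n).

Definition moment_functional L : Prop :=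
  exists mu : {measure set borel_space -> \bar R},
    forall P,
      mu.-integrable [set: borel_space] (fun x => (peval P x)%:E) /\
      (L P)%:E = (\int[mu]_x (peval P x)%:E)%E.

Definition vanishes_on L I : Prop := forall Q, I Q -> L Q = 0.

Definition type_A P : Prop :=
  forall L, positive_definite L -> vanishes_on L (principal_ideal P) ->
    moment_functional L.

Definition type_B P : Prop :=
  forall L, positive_definite L ->
    vanishes_on L (vanishing_ideal (zero_set P)) -> moment_functional L.

(* The types of an algebraic set do not depend on the inducing polynomial:
   this is immediate for type B, but for type A it is not, as (P) is not
   determined by the zero set of P.  Quantifying universally over P makes no
   use of this independence.  At least one such P exists when V is algebraic
   (the sum of the squares of finitely many generators of an ideal). *)
Definition set_type_A V : Prop := forall P, induced_by V P -> type_A P.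

Definition set_type_B V : Prop := forall P, induced_by V P -> type_B P.

End Defs.

(* Main.v *)
(* Only the implication from type B to type A needs work: a positive definite
   functional L vanishing on (P) must vanish on every Q vanishing on the zero
   set of P.  If L Q <> 0, then by Cauchy-Schwarz no -Q^(2k) is a sum of squares
   modulo P, so Zorn's lemma yields a prime cone of R[X_1, ..., X_n] (an order
   on a residue field) whose support contains P but not Q.  The countable
   subfield generated by the coefficients of P and Q and by the classes of the
   X_i embeds into a real closed field, obtained as a maximal ordered subfield
   of its algebraic closure, and there the X_i form a zero of P that is not a
   zero of Q.  Quantifier elimination carries such a point over to R^n, since
   the same polynomial inequalities with rational coefficients hold between the
   coefficients of P and Q in both fields: a contradiction. *)
Require Import Defs.
From mathcomp Require Import all_boot all_order all_algebra.
From mathcomp Require Import all_classical all_reals all_analysis.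
From mathcomp Require Import all_field.
From mathcomp Require Import ring zify.
From mathcomp Require Import qe_rcf_th qe_rcf.
From HB Require Import structures.
From mathcomp Require mpoly.
Import -(notations) mpoly.

Set Implicit Arguments.
Unset Strict Implicit.
Unset Printing Implicit Defensive.

Import Order.TTheory GRing.Theory Num.Theory.
Local Open Scope ring_scope.
Local Open Scope classical_set_scope.

(** * Transfer of quantifier-free formulas between real closed fields *)

Section MapFormula.
Variables (F1 F2 : realFieldType) (h : {rmorphism F1 -> F2}).

Fixpoint map_term (t : term F1) : term F2 :=
  match t with
  | Var i => Var _ i
  | Const c => Const (h c)
  | NatConst n => NatConst _ n
  | Add u v => Add (map_term u) (map_term v)
  | Opp u => Opp (map_term u)
  | NatMul u n => NatMul (map_term u) n
  | Mul u v => Mul (map_term u) (map_term v)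
  | Exp u n => Exp (map_term u) n
  end.

Fixpoint map_formula (f : formula F1) : formula F2 :=
  match f with
  | Bool b => Bool b
  | Equal u v => Equal (map_term u) (map_term v)
  | Lt u v => Lt (map_term u) (map_term v)
  | Le u v => Le (map_term u) (map_term v)
  | And f g => And (map_formula f) (map_formula g)
  | Or f g => Or (map_formula f) (map_formula g)
  | Implies f g => Implies (map_formula f) (map_formula g)
  | Not f => Not (map_formula f)
  end.

Notation mt := map_term.
Notation mp := (map map_term).
Notation mf := map_formula.

Lemma map_Size p k k' : (forall n, mf (k n) = k' n) ->
  mf (Size p k) = Size (mp p) k'.
Proof.
elim: p k k' => [|c p ih] k k' Hk /=; first exact: Hk.
by apply: ih => -[|n] /=; rewrite ?Hk.
Qed.

Lemma map_Isnull p k k' : (forall b, mf (k b) = k' b) ->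
  mf (Isnull p k) = Isnull (mp p) k'.
Proof. by move=> Hk; apply: map_Size. Qed.

Lemma map_LeadCoef p k k' : (forall l, mf (k l) = k' (mt l)) ->
  mf (LeadCoef p k) = LeadCoef (mp p) k'.
Proof.
elim: p k k' => [|c p ih] k k' Hk /=; first by rewrite Hk /= rmorph0.
by apply: ih => l /=; rewrite /If /= !Hk.
Qed.

Lemma map_AmulXn a n : mp (AmulXn a n) = AmulXn (mt a) n.
Proof. by elim: n => //= n ->; rewrite rmorph0. Qed.

Lemma map_AddPoly p q : mp (AddPoly p q) = AddPoly (mp p) (mp q).
Proof. by elim: p q => [|a p ih] [|b q] //=; rewrite ih. Qed.

Lemma map_ScalPoly c p : mp (ScalPoly c p) = ScalPoly (mt c) (mp p).
Proof. by rewrite /ScalPoly -!map_comp. Qed.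

Lemma map_MulPoly p q : mp (MulPoly p q) = MulPoly (mp p) (mp q).
Proof. by elim: p => //= a p ih; rewrite map_AddPoly map_ScalPoly /= ih. Qed.

Lemma map_ExpPoly p n : mp (ExpPoly p n) = ExpPoly (mp p) n.
Proof.
case: n => [|n] //; rewrite /ExpPoly !iteropS.
by elim: n => //= n ih; rewrite map_MulPoly ih.
Qed.

Lemma map_OppPoly p : mp (OppPoly p) = OppPoly (mp p).
Proof. by rewrite /OppPoly map_ScalPoly /= rmorphN1. Qed.

Lemma map_NatMulPoly n p : mp (NatMulPoly n p) = NatMulPoly n (mp p).
Proof. by rewrite /NatMulPoly map_ScalPoly. Qed.

Lemma map_Deriv p : mp (Deriv p) = Deriv (mp p).
Proof. by elim: p => //= a p ih; rewrite map_AddPoly /= ih. Qed.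

Lemma map_Rediv_rec_loop q sq cq c qq r n k k' :
  (forall d, mf (k d) = k' (d.1.1, mp d.1.2, mp d.2)) ->
  mf (Rediv_rec_loop q sq cq c qq r n k) =
  Rediv_rec_loop (mp q) sq (mt cq) c (mp qq) (mp r) n k'.
Proof.
elim: n c qq r k k' => [|n ih] c qq r k k' Hk /=; apply: map_Size => sr;
  case: ifP => _; rewrite ?Hk //; apply: map_LeadCoef => l.
  by rewrite Hk /= ?(map_AddPoly, map_MulPoly, map_OppPoly, map_AmulXn).
rewrite (ih _ _ _ _ k') //.
by rewrite ?(map_AddPoly, map_MulPoly, map_OppPoly, map_AmulXn).
Qed.

Lemma map_Rediv p q k k' :
  (forall d, mf (k d) = k' (d.1.1, mp d.1.2, mp d.2)) ->
  mf (Rediv p q k) = Rediv (mp p) (mp q) k'.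
Proof.
move=> Hk; apply: map_Isnull => -[]; first by rewrite Hk /= rmorph0.
apply: map_Size => sq; apply: map_Size => sp; apply: map_LeadCoef => l.
by rewrite (map_Rediv_rec_loop _ _ _ _ _ _ _ Hk) /= rmorph0.
Qed.

Lemma map_Rmod p q k k' : (forall r, mf (k r) = k' (mp r)) ->
  mf (Rmod p q k) = Rmod (mp p) (mp q) k'.
Proof. by move=> Hk; apply: map_Rediv => d; rewrite Hk. Qed.

Lemma map_Rscal p q k k' : (forall n, mf (k n) = k' n) ->
  mf (Rscal p q k) = Rscal (mp p) (mp q) k'.
Proof. by move=> Hk; apply: map_Rediv => d; rewrite Hk. Qed.

Lemma map_Rgcd_loop n p q k k' : (forall r, mf (k r) = k' (mp r)) ->
  mf (Rgcd_loop n p q k) = Rgcd_loop n (mp p) (mp q) k'.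
Proof.
elim: n p q k k' => [|n ih] p q k k' Hk /=;
  apply: map_Rmod => r; apply: map_Isnull => -[] //.
exact: ih.
Qed.

Lemma map_Rgcd p q k k' : (forall r, mf (k r) = k' (mp r)) ->
  mf (Rgcd p q k) = Rgcd (mp p) (mp q) k'.
Proof.
move=> Hk; rewrite /Rgcd /LtSize; apply: map_Size => n; apply: map_Size => m.
by case: ifP => _; apply: map_Isnull => -[] //; apply: map_Size => s;
  apply: map_Rgcd_loop.
Qed.

Lemma map_BigRgcd ps k k' : (forall r, mf (k r) = k' (mp r)) ->
  mf (BigRgcd ps k) = BigRgcd (map mp ps) k'.
Proof.
elim: ps k k' => [|p ps ih] k k' Hk /=; first by rewrite Hk /= rmorph0.
by apply: ih => r; apply: map_Rgcd.
Qed.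

Lemma map_Changes s k k' : (forall n, mf (k n) = k' n) ->
  mf (Changes s k) = Changes (mp s) k'.
Proof.
elim: s k k' => [|a s ih] k k' Hk /=; first exact: Hk.
by apply: ih => v; rewrite /If /= !Hk; case: s.
Qed.

Lemma map_SeqPInfty ps k k' : (forall s, mf (k s) = k' (mp s)) ->
  mf (SeqPInfty ps k) = SeqPInfty (map mp ps) k'.
Proof.
elim: ps k k' => [|p ps ih] k k' Hk /=; first exact: Hk.
by apply: map_LeadCoef => l; apply: ih => s; rewrite Hk.
Qed.

Lemma map_SeqMInfty ps k k' : (forall s, mf (k s) = k' (mp s)) ->
  mf (SeqMInfty ps k) = SeqMInfty (map mp ps) k'.
Proof.
elim: ps k k' => [|p ps ih] k k' Hk /=; first exact: Hk.
apply: map_LeadCoef => l; apply: map_Size => n; apply: ih => s.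
by rewrite Hk /= rmorphN1.
Qed.

Lemma map_ChangesPoly ps k k' : (forall n, mf (k n) = k' n) ->
  mf (ChangesPoly ps k) = ChangesPoly (map mp ps) k'.
Proof.
move=> Hk; apply: map_SeqMInfty => s; apply: map_SeqPInfty => s'.
by apply: map_Changes => v; apply: map_Changes => v'; rewrite Hk.
Qed.

Lemma map_NextMod p q k k' : (forall r, mf (k r) = k' (mp r)) ->
  mf (NextMod p q k) = NextMod (mp p) (mp q) k'.
Proof.
move=> Hk; apply: map_LeadCoef => l; apply: map_Rscal => n.
by apply: map_Rmod => r; rewrite Hk map_ScalPoly.
Qed.

Lemma map_ModsAux p q n k k' : (forall s, mf (k s) = k' (map mp s)) ->
  mf (ModsAux p q n k) = ModsAux (mp p) (mp q) n k'.
Proof.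
elim: n p q k k' => [|n ih] p q k k' Hk /=; first by rewrite Hk.
apply: map_Isnull => -[]; first by rewrite Hk.
by apply: map_NextMod => r; apply: ih => s; rewrite Hk.
Qed.

Lemma map_Mods p q k k' : (forall s, mf (k s) = k' (map mp s)) ->
  mf (Mods p q k) = Mods (mp p) (mp q) k'.
Proof.
by move=> Hk; apply: map_Size => n; apply: map_Size => m; apply: map_ModsAux.
Qed.

Lemma map_reducebig (T : Type) (s : seq T) f :
  mp (reducebig [:: NatConst _ 1] s
    (fun i => BigBody i (@MulPoly F1) true (f i)))
  = reducebig [:: NatConst _ 1] s
      (fun i => BigBody i (@MulPoly F2) true (mp (f i))).
Proof. by elim: s => //= i s ih; rewrite map_MulPoly ih. Qed.

Lemma map_PolyComb sq sc : mp (PolyComb sq sc) = PolyComb (map mp sq) sc.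
Proof.
rewrite /PolyComb map_reducebig size_map; elim: (iota _ _) => //= i s ->.
congr MulPoly; rewrite map_ExpPoly; congr ExpPoly.
by have [lti|lei] := ltnP i (size sq);
  [rewrite (nth_map [::]) | rewrite !nth_default ?size_map].
Qed.

Lemma map_Pcq sq i : mp (Pcq sq i) = Pcq (map mp sq) i.
Proof.
rewrite /Pcq size_map.
have [lti|lei] := ltnP i (size (sg_tab (size sq))).
  by rewrite !(nth_map [::]) // map_PolyComb.
by rewrite !nth_default ?size_map.
Qed.

Lemma map_TaqR p q k k' : (forall n, mf (k n) = k' n) ->
  mf (TaqR p q k) = TaqR (mp p) (mp q) k'.
Proof.
move=> Hk; rewrite /TaqR -map_Deriv -map_MulPoly.
by apply: map_Mods => s; apply: map_ChangesPoly.
Qed.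

Lemma map_TaqsR p sq i k k' : (forall t, mf (k t) = k' (mt t)) ->
  mf (TaqsR p sq i k) = TaqsR (mp p) (map mp sq) i k'.
Proof.
move=> Hk; rewrite /TaqsR -map_Pcq; apply: map_TaqR => n.
by rewrite Hk /= rmorph_int.
Qed.

Lemma rmorph_coefs n i : h (coefs F1 n i) = coefs F2 n i.
Proof.
rewrite /coefs; have [lti|lei] := ltnP i (3 ^ n); last first.
  by rewrite !nth_default ?rmorph0 // size_map size_enum_ord.
rewrite !(nth_map (Ordinal lti)) -?enumT ?size_enum_ord // !castmxE.
set a := cast_ord _ (nth _ _ i); set b := cast_ord _ ord0.
rewrite -[LHS](mxE map_mx_key (fun i j => h (invmx _ i j))).
rewrite -[LHS]/(map_mx h _ a b) map_invmx -map_mx_comp.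
by congr (invmx _ _ _); apply/matrixP => i1 j1; rewrite !mxE /= rmorph_int.
Qed.

Lemma map_Coefs n i : mt (Coefs F1 n i) = Coefs F2 n i.
Proof.
case: n => [|[|n]]; rewrite /Coefs /= ?rmorph_nat ?rmorph_coefs //.
by congr Const; case: i => [|[|[|i]]] /=;
  rewrite ?fmorphV ?rmorph_nat ?nth_nil ?rmorph0.
Qed.

Lemma map_CcountWeak p sq k k' : (forall t, mf (k t) = k' (mt t)) ->
  mf (CcountWeak p sq k) = CcountWeak (mp p) (map mp sq) k'.
Proof.
rewrite /CcountWeak size_map -[X in _ -> _ = _ X _ _]/(mt (NatConst _ 0)).
elim: (3 ^ _)%N (NatConst _ _) k k' => [|n ih] t k k' Hk /=; first exact: Hk.
apply: map_TaqsR => x; rewrite (ih _ _ k') //.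
by rewrite -map_Coefs.
Qed.

Lemma map_BoundingPoly sq : mp (BoundingPoly sq) = BoundingPoly (map mp sq).
Proof.
rewrite /BoundingPoly map_Deriv; congr Deriv.
by elim: sq => //= q sq ih; rewrite map_MulPoly ih.
Qed.

Lemma map_CcountGt0 sp sq :
  mf (CcountGt0 sp sq) = CcountGt0 (map mp sp) (map mp sq).
Proof.
apply: map_BigRgcd => p; apply: map_Isnull => -[] /=; last first.
  exact: map_CcountWeak.
rewrite -map_BoundingPoly; apply: map_CcountWeak => c /=.
congr (Or _ (Or _ _)).
  by elim: sq => //= q sq ->; congr And; apply: map_LeadCoef.
elim: sq => //= q sq ->; congr And.
by apply: map_Size => n; apply: map_LeadCoef.
Qed.

Lemma map_abstrX i t : mp (abstrX i t) = abstrX i (mt t).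
Proof.
elim: t => //= [n|u <- v <-|u <-|u <- n|u <- v <-|u <- n].
- by case: ifP.
- exact: map_AddPoly.
- exact: map_OppPoly.
- exact: map_NatMulPoly.
- exact: map_MulPoly.
- exact: map_ExpPoly.
Qed.

End MapFormula.

Section Transfer.

Definition reval (F : rcfType) (e : seq F) (t : term rat) : F :=
  eval e (map_term ratr t).

Definition rholds (F : rcfType) (e : seq F) (f : formula rat) : bool :=
  qf_eval e (map_formula ratr f).

Definition sign_cond (F : rcfType) (e : seq F) (sp sq : seq (term rat)) :=
  all (fun t => reval e t == 0) sp && all (fun t => 0 < reval e t) sq.

Lemma sign_cond_cat (F : rcfType) (e : seq F) sp sq sp' sq' :
  sign_cond e (sp ++ sp') (sq ++ sq') =
  sign_cond e sp sq && sign_cond e sp' sq'.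
Proof. by rewrite /sign_cond !all_cat andbACA. Qed.

Lemma sign_cond_term (F : rcfType) (e : seq F) t :
  exists sp sq, sign_cond e sp sq /\
    forall (G : rcfType) (g : seq G), sign_cond g sp sq ->
      (0 <= reval g t) = (0 <= reval e t) /\
      (reval g t <= 0) = (reval e t <= 0).
Proof.
case: (ltrgt0P (reval e t)) => et.
- exists [::], [:: t]; rewrite /sign_cond /= et; split=> // G g.
  by rewrite andbT => gt; rewrite ltW // leNgt gt.
- exists [::], [:: Opp t]; rewrite /sign_cond /= /reval /= oppr_gt0.
  split; first by rewrite et.
  by move=> G g; rewrite oppr_gt0 andbT => gt; rewrite leNgt gt ltW.
- exists [:: t], [::]; rewrite /sign_cond /= et eqxx; split=> // G g.
  by rewrite !andbT => /eqP->; rewrite lexx.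
Qed.

Lemma sign_cond_formula (F : rcfType) (e : seq F) f :
  exists sp sq, sign_cond e sp sq /\
    forall (G : rcfType) (g : seq G), sign_cond g sp sq ->
      rholds g f = rholds e f.
Proof.
have atom u v : exists sp sq, sign_cond e sp sq /\
    forall (G : rcfType) (g : seq G), sign_cond g sp sq ->
     (reval g u <= reval g v) = (reval e u <= reval e v) /\
     (reval g v <= reval g u) = (reval e v <= reval e u).
  have [sp [sq [esp gsp]]] := sign_cond_term e (Add u (Opp v)).
  exists sp, sq; split=> // G g /gsp; rewrite /reval /= !subr_ge0 !subr_le0.
  by case=> -> ->.
have bin f1 f2 : (exists sp sq, sign_cond e sp sq /\
    forall (G : rcfType) (g : seq G), sign_cond g sp sq ->
      rholds g f1 = rholds e f1) ->
    (exists sp sq, sign_cond e sp sq /\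
    forall (G : rcfType) (g : seq G), sign_cond g sp sq ->
      rholds g f2 = rholds e f2) ->
    exists sp sq, sign_cond e sp sq /\
    forall (G : rcfType) (g : seq G), sign_cond g sp sq ->
      rholds g f1 = rholds e f1 /\ rholds g f2 = rholds e f2.
  move=> [sp [sq [e1 g1]]] [sp' [sq' [e2 g2]]].
  exists (sp ++ sp'), (sq ++ sq'); rewrite sign_cond_cat e1 e2; split=> // G g.
  by rewrite sign_cond_cat => /andP[/g1 -> /g2 ->].
elim: f => [b|u v|u v|u v|f1 ih1 f2 ih2|f1 ih1 f2 ih2|f1 ih1 f2 ih2|f1 ih1].
- by exists [::], [::].
- have [sp [sq [esp gsp]]] := atom u v.
  exists sp, sq; split=> // G g /gsp[]; rewrite /reval /rholds /= => uv vu.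
  by rewrite !eq_le uv vu.
- have [sp [sq [esp gsp]]] := atom u v.
  exists sp, sq; split=> // G g /gsp[]; rewrite /reval /rholds /= => uv vu.
  by rewrite !ltNge vu.
- have [sp [sq [esp gsp]]] := atom u v.
  by exists sp, sq; split=> // G g /gsp[]; rewrite /reval /rholds.
- have [sp [sq [esp gsp]]] := bin _ _ ih1 ih2.
  exists sp, sq; split=> // G g /gsp[]; rewrite /rholds /=; by move=> -> ->.
- have [sp [sq [esp gsp]]] := bin _ _ ih1 ih2.
  exists sp, sq; split=> // G g /gsp[]; rewrite /rholds /=; by move=> -> ->.
- have [sp [sq [esp gsp]]] := bin _ _ ih1 ih2.
  exists sp, sq; split=> // G g /gsp[]; rewrite /rholds /=; by move=> -> ->.
- have [sp [sq [esp gsp]]] := ih1.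
  exists sp, sq; split=> // G g /gsp; rewrite /rholds /=; by move=> ->.
Qed.

(* The elimination is run once, over [rat], and its result is then evaluated in
   every real closed field. *)
Definition elim_var i (sp sq : seq (term rat)) : formula rat :=
  CcountGt0 (map (abstrX i) sp) (map (abstrX i) sq).

Lemma elim_varP (F : rcfType) (e : seq F) i sp sq :
  reflect (exists x, sign_cond (set_nth 0 e i x) sp sq)
          (rholds e (elim_var i sp sq)).
Proof.
rewrite /rholds /elim_var map_CcountGt0 eval_CcountGt0.
apply: (equivP (ccount_gt0P _ _)).
suff E x : \big[andb/true]_(p <- map (eval_poly e) (map (map (map_term ratr))
      (map (abstrX i) sp))) (p.[x] == 0) &&
    \big[andb/true]_(p <- map (eval_poly e) (map (map (map_term ratr))
      (map (abstrX i) sq))) (0 < p.[x]) = sign_cond (set_nth 0 e i x) sp sq.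
  by split=> -[x Hx]; exists x; rewrite ?E // -E.
by rewrite /sign_cond !big_all !all_map; congr (_ && _); apply: eq_all => t /=;
  rewrite map_abstrX abstrXP.
Qed.

Lemma rcf_transfer (F G : rcfType) (c : seq F) (c' : seq G) :
  size c = size c' ->
  (forall t, (0 <= reval c t) = (0 <= reval c' t)) ->
  forall f x, rholds (c ++ x) f ->
  exists2 x', size x' = size x & rholds (c' ++ x') f.
Proof.
move=> szc cc' f x; elim/last_ind: x f => [|x y ih] f fx.
  exists [::] => //; move: fx; rewrite !cats0.
  have [sp [sq [csp fsp]]] := sign_cond_formula c f; rewrite (fsp G c') //.
  have cc'N t : (reval c t <= 0) = (reval c' t <= 0).
    by have := cc' (Opp t); rewrite /reval /= !oppr_ge0.
  move: csp; congr (_ && _); apply: eq_all => t.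
    by rewrite !eq_le cc' cc'N.
  by rewrite !ltNge cc'N.
have [sp [sq [csp fsp]]] := sign_cond_formula (c ++ rcons x y) f.
have set_rcons (K : rcfType) (e u : seq K) v i : (size e + size u = i)%N ->
    set_nth 0 (e ++ u) i v = e ++ rcons u v.
  by move=> <-; rewrite -size_cat -rcons_cat; elim: (e ++ u) => //= a s ->.
have /ih[x' szx' /elim_varP[y' csp']] :
    rholds (c ++ x) (elim_var (size c + size x)%N sp sq).
  by apply/elim_varP; exists y; rewrite set_rcons.
rewrite set_rcons -?szc ?szx' // in csp'.
by exists (rcons x' y'); rewrite ?size_rcons ?szx' // (fsp _ _ csp').
Qed.

End Transfer.

(** * Prime cones and their residue fields *)

Lemma Zorn_nonempty_chains (T : Type) (P : set (set T)) (A0 : set T) :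
  P A0 ->
  (forall F : set (set T), F `<=` P -> total_on F subset -> F !=set0 ->
    P (\bigcup_(X in F) X)) ->
  exists A, P A /\ forall B, A `<=` B -> P B -> B = A.
Proof.
move=> PA0 Pcup.
have [F FP Ftot|A [PA maxA]] := @Zorn_bigcup T (fun A => A = set0 \/ P A).
  have [[X [FX PX]]|noP] := pselect (exists X, F X /\ P X).
    right; rewrite (_ : \bigcup_(X in F) X = \bigcup_(X in F `&` P) X).
      apply: Pcup; [by move=> Y []| |by exists X].
      by move=> Y Z [FY _] [FZ _]; apply: Ftot.
    apply/seteqP; split=> z [Y FY Yz]; last by exists Y => //; case: FY.
    exists Y => //; split=> //.
    by case: (FP _ FY) => // Y0; rewrite Y0 in Yz.
  left; apply/seteqP; split=> z // [Y FY Yz].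
  case: (FP _ FY) => [Y0|PY]; first by rewrite Y0 in Yz.
  by case: noP; exists Y.
have maxA' B : A `<=` B -> P B -> B = A.
  move=> AB PB; apply: contrapT => neBA; apply: (maxA B); last by right.
  by rewrite properEneq; split=> //; apply/eqP => /esym.
case: PA => [A_eq0|]; last by move=> PA; exists A.
exists A; split=> //; rewrite -(maxA' A0) //.
by rewrite A_eq0; exact: sub0set.
Qed.

Section PrimeCone.
Variable B : comNzRingType.
Implicit Types (T : set B) (x y q : B).

Definition precone T := [/\ forall x y, T x -> T y -> T (x + y),
  forall x y, T x -> T y -> T (x * y) & forall x, T (x ^+ 2)].

Definition supp T : set B := [set x | T x /\ T (- x)].

Definition prime_cone T := [/\ precone T, forall x, T x \/ T (- x),
  ~ T (- 1) & forall x y, supp T (x * y) -> supp T x \/ supp T y].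

Lemma preconeD T x y : precone T -> T x -> T y -> T (x + y).
Proof. by case=> TD _ _; apply: TD. Qed.

Lemma preconeM T x y : precone T -> T x -> T y -> T (x * y).
Proof. by case=> _ TM _; apply: TM. Qed.

Lemma precone_sqr T x : precone T -> T (x ^+ 2).
Proof. by case. Qed.

Lemma precone0 T : precone T -> T 0.
Proof. by move=> /(precone_sqr 0); rewrite expr0n. Qed.

Lemma precone1 T : precone T -> T 1.
Proof. by move=> /(precone_sqr 1); rewrite expr1n. Qed.

Lemma preconeX T x k : precone T -> T x -> T (x ^+ k).
Proof.
move=> pT Tx; elim: k => [|k ih]; first exact: precone1.
by rewrite exprS; apply: preconeM.
Qed.

Lemma suppN T x : supp T x -> supp T (- x).
Proof. by rewrite /supp /= opprK => -[]. Qed.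

Lemma suppD T x y : precone T -> supp T x -> supp T y -> supp T (x + y).
Proof.
by move=> pT [x1 x2] [y1 y2]; rewrite /supp /= opprD; split; apply: preconeD.
Qed.

Lemma suppM T x y : prime_cone T -> supp T x -> supp T (y * x).
Proof.
move=> [pT Tt _ _] [x1 x2].
have [Ty|Ty] := Tt y; split.
- exact: preconeM.
- by rewrite -mulrN; apply: preconeM.
- by rewrite -mulrNN; apply: preconeM.
- by rewrite -mulNr; apply: preconeM.
Qed.

Definition cone_adjoin T x : set B :=
  [set z | exists s t, [/\ T s, T t & z = s + x * t]].

Lemma precone_adjoin T x : precone T -> precone (cone_adjoin T x).
Proof.
move=> pT; split.
- move=> _ _ [s [t [Ts Tt ->]]] [s' [t' [Ts' Tt' ->]]].
  by exists (s + s'), (t + t'); split; [exact: preconeD|exact: preconeD|ring].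
- move=> _ _ [s [t [Ts Tt ->]]] [s' [t' [Ts' Tt' ->]]].
  exists (s * s' + x ^+ 2 * (t * t')), (s * t' + t * s'); split; last by ring.
    by do ![apply: precone_sqr => //|apply: preconeD => //|
         apply: preconeM => //].
  by do ![apply: preconeD => //|apply: preconeM => //].
- move=> z; exists (z ^+ 2), 0; split; [exact: precone_sqr|exact: precone0|].
  by ring.
Qed.

Lemma sub_cone_adjoin T x : precone T -> T `<=` cone_adjoin T x.
Proof.
move=> pT z Tz; exists z, 0; split; rewrite ?mulr0 ?addr0 //.
exact: precone0.
Qed.

Lemma cone_adjoin_mem T x : precone T -> cone_adjoin T x x.
Proof.
by move=> pT; exists 0, 1; split; [exact: precone0|exact: precone1|ring].
Qed.

Lemma prime_cone_exists (T0 : set B) q :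
  precone T0 -> (forall k, ~ T0 (- (q ^+ 2) ^+ k)) ->
  exists T, [/\ T0 `<=` T, prime_cone T & ~ supp T q].
Proof.
move=> pT0 qT0.
pose good T := [/\ T0 `<=` T, precone T & forall k, ~ T (- (q ^+ 2) ^+ k)].
have [|F Fgood Ftot [X FX]|T [[T0T pT qT] maxT]] :=
  @Zorn_nonempty_chains B good T0; first by split.
  split.
  - by move=> z T0z; exists X => //; have [+ _ _] := Fgood _ FX; apply.
  - split.
    + move=> x y [Y FY Yx] [Z FZ Zy].
      have [_ pY _] := Fgood _ FY; have [_ pZ _] := Fgood _ FZ.
      have [YZ|ZY] := Ftot _ _ FY FZ.
        by exists Z => //; apply: preconeD => //; apply: YZ.
      by exists Y => //; apply: preconeD => //; apply: ZY.
    + move=> x y [Y FY Yx] [Z FZ Zy].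
      have [_ pY _] := Fgood _ FY; have [_ pZ _] := Fgood _ FZ.
      have [YZ|ZY] := Ftot _ _ FY FZ.
        by exists Z => //; apply: preconeM => //; apply: YZ.
      by exists Y => //; apply: preconeM => //; apply: ZY.
    + move=> x; exists X => //; have [_ pX _] := Fgood _ FX.
      exact: precone_sqr.
  - by move=> k [Y FY Yq]; have [_ _ /(_ k)] := Fgood _ FY; apply.
have adj x : ~ T x -> exists k s t, [/\ T s, T t & - (q ^+ 2) ^+ k = s + x * t].
  move=> nTx; apply: contrapT => nex; apply: nTx.
  rewrite -(maxT (cone_adjoin T x)); first exact: cone_adjoin_mem.
    exact: sub_cone_adjoin.
  split; [|exact: precone_adjoin|].
    by apply: subset_trans (sub_cone_adjoin _ pT).
  by move=> k [s [t [Ts Tt E]]]; apply: nex; exists k, s, t.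
have Tq k : T ((q ^+ 2) ^+ k) by apply: preconeX => //; apply: precone_sqr.
have prod_out u v k l s t s' t' : T s -> T t -> T s' -> T t' ->
    - (q ^+ 2) ^+ k = s + u * t -> - (q ^+ 2) ^+ l = s' + v * t' ->
    ~ T (- (u * v)).
  move=> Ts Tt Ts' Tt' E E' Tuv; apply: (qT (k + l)%N).
  rewrite (_ : - _ = s * (q ^+ 2) ^+ l + (q ^+ 2) ^+ k * s' + s * s' +
    - (u * v) * (t * t')).
    by do ![apply: precone_sqr => //|apply: preconeD => //|
         apply: preconeM => //].
  have -> : - (u * v) * (t * t') = - ((u * t) * (v * t')) by ring.
  have -> : u * t = - ((q ^+ 2) ^+ k) - s by rewrite E; ring.
  have -> : v * t' = - ((q ^+ 2) ^+ l) - s' by rewrite E'; ring.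
  by rewrite exprD; ring.
have Tt x : T x \/ T (- x).
  have [|/adj[k [s [t [Ts Tt E]]]]] := pselect (T x); first by left.
  have [|/adj[l [s' [t' [Ts' Tt' E']]]]] := pselect (T (- x)); first by right.
  have := prod_out _ _ _ _ _ _ _ _ Ts Tt Ts' Tt' E E'.
  by rewrite mulrN opprK -expr2; case; apply: precone_sqr.
exists T; split=> //; last first.
  move=> [Tq1 Tq2]; apply: (qT 1%N); rewrite expr1 expr2 -mulrN.
  exact: preconeM.
split=> //; first by have := qT 0%N.
have aux x y : ~ T x -> ~ T y -> ~ T (- (x * y)).
  move=> /adj[k [s [t [Ts Tt' E]]]] /adj[l [s' [t' [Ts' Tt'' E']]]].
  exact: prod_out Ts Tt' Ts' Tt'' E E'.
move=> x y [xy1 xy2]; apply: contrapT => /not_orP[/not_andP nx /not_andP ny].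
case: nx => nx; case: ny => ny; move: (aux _ _ nx ny);
  by rewrite ?mulrNN ?mulrN ?mulNr ?opprK.
Qed.

End PrimeCone.

Section ResidueField.
Variables (B : comNzRingType) (T : set B) (hT : prime_cone T).

Definition suppb : B -> bool := fun x => `[< supp T x >].

Lemma suppb_idealr : idealr_closed suppb.
Proof.
have [pT _ T1 _] := hT; have T0 := precone0 pT; split.
- by apply/asboolP; split; rewrite ?oppr0.
- by apply/negP => /asboolP[_] /T1.
- move=> a u v /asboolP su /asboolP sv; apply/asboolP.
  by apply: suppD => //; apply: suppM.
Qed.

Lemma suppb_prime : prime_idealr_closed suppb.
Proof.
have [_ _ _ Tp] := hT.
by move=> u v /asboolP /Tp[] ?; apply/orP; [left|right]; apply/asboolP.
Qed.

HB.instance Definition _ := isIdealr.Build B suppb suppb_idealr.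
HB.instance Definition _ := isPrimeIdealrClosed.Build B suppb suppb_prime.

Definition residue_ring : Type := {ideal_quot (suppb : idealr B)}.
HB.instance Definition _ := GRing.ComNzRing.on residue_ring.

Definition residue_unit : pred residue_ring :=
  fun x => `[< exists y, y * x = 1 >].

Definition residue_inv (x : residue_ring) : residue_ring :=
  if pselect (exists y, y * x = 1) is left h then projT1 (cid h) else x.

Lemma residue_mulVx : {in residue_unit, left_inverse 1 residue_inv *%R}.
Proof.
move=> x /asboolP hx; rewrite /residue_inv; case: pselect => // h.
by case: cid.
Qed.

Lemma residue_unitPl x y : y * x = 1 -> residue_unit x.
Proof. by move=> yx; apply/asboolP; exists y. Qed.

Lemma residue_inv_out : {in [predC residue_unit], residue_inv =1 id}.
Proof.
move=> x /negP hx; rewrite /residue_inv; case: pselect => // h.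
by case: hx; apply/asboolP.
Qed.

HB.instance Definition _ := GRing.ComNzRing_hasMulInverse.Build residue_ring
  residue_mulVx residue_unitPl residue_inv_out.
HB.instance Definition _ := GRing.ComUnitRing_isIntegral.Build residue_ring
  (@Quotient.rquot_IdomainAxiom B (suppb : prime_idealr B)).

Lemma residue_field : exists (E : fieldType) (phi : {rmorphism B -> E}),
  forall x, phi x = 0 <-> supp T x.
Proof.
pose pi : B -> residue_ring := \pi_({ideal_quot (suppb : idealr B)})%qT.
have piD : zmod_morphism pi by move=> x y; rewrite /pi rmorphB.
have pi1 : monoid_morphism pi.
  by split; [rewrite /pi rmorph1|move=> x y; rewrite /pi rmorphM].
pose H1 := GRing.isZmodMorphism.Build _ _ pi piD.
pose H2 := GRing.isMonoidMorphism.Build _ _ pi pi1.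
pose piR : {rmorphism B -> residue_ring} := HB.pack pi H1 H2.
exists {fraction residue_ring}, (@FracField.tofrac residue_ring \o piR)%FUN.
move=> x /=.
split.
  move=> /eqP; rewrite tofrac_eq0 /pi => /eqP p0.
  have : (x == 0 %[mod {ideal_quot (suppb : idealr B)}])%qT.
    by apply/eqP; rewrite p0 rmorph0.
  by rewrite -Quotient.idealrBE subr0 => /asboolP.
move=> sx; apply/eqP; rewrite tofrac_eq0.
have : (x == 0 %[mod {ideal_quot (suppb : idealr B)}])%qT.
  by rewrite -Quotient.idealrBE subr0; apply/asboolP.
by rewrite /= /pi => /eqP ->; rewrite rmorph0.
Qed.

End ResidueField.

(** * Orders on subfields *)

Section OrderCone.
Variable E : fieldType.
Implicit Types (T : set E) (x y : E).

(* The nonnegative elements of an order on the subfield [T - T] of [E]. *)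
Definition order_cone T := [/\ T 1,
  (forall x y, T x -> T y -> T (x + y)) /\
  (forall x y, T x -> T y -> T (x * y)),
  forall x, T x -> T x^-1,
  forall x, T x -> T (- x) -> x = 0 &
  forall x y, T x -> T y -> T (x - y) \/ T (y - x)].

Definition cone_field_pred T : pred E := fun x => `[< T x \/ T (- x) >].

Lemma cone_field_closed T : order_cone T -> divring_closed (cone_field_pred T).
Proof.
move=> hT; have [T1 [TD TM] TV _ Tt] := hT; split.
- by apply/asboolP; left.
- move=> x y /asboolP[Tx|Tx] /asboolP[Ty|Ty]; apply/asboolP; rewrite opprB.
  + exact: Tt.
  + by left; apply: TD.
  + by right; rewrite addrC; apply: TD => //; rewrite opprK.
  + have := Tt _ _ Tx Ty; rewrite opprK [- x + y]addrC opprK [- y + x]addrC.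
    by case; [right|left].
- move=> x y /asboolP[Tx|Tx] /asboolP[Ty|Ty]; apply/asboolP.
  + by left; apply: TM => //; apply: TV.
  + by right; rewrite -mulrN -invrN; apply: TM => //; apply: TV.
  + by right; rewrite -mulNr; apply: TM => //; apply: TV.
  + by left; rewrite -mulrNN -invrN; apply: TM => //; apply: TV.
Qed.

End OrderCone.

Section FracCone.
Variables (B : comNzRingType) (E : fieldType) (phi : {rmorphism B -> E}).
Variable T : set B.

Definition frac_cone : set E :=
  [set z | exists a b, [/\ T a, T b, phi b != 0 & z = phi a / phi b]].

Hypotheses (hT : prime_cone T) (kerphi : forall x, phi x = 0 <-> supp T x).

Lemma frac_cone_ext a : T a -> frac_cone (phi a).
Proof.
have [pT _ _ _] := hT.
move=> Ta; exists a, 1; rewrite rmorph1 oner_eq0 divr1; split=> //.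
exact: precone1.
Qed.

Lemma frac_cone_order : order_cone frac_cone.
Proof.
have [pT Tt _ Tp] := hT; split.
- by rewrite -(rmorph1 phi); apply: frac_cone_ext; apply: precone1.
- split=> _ _ [a [b [Ta Tb b0 ->]]] [c [d [Tc Td d0 ->]]].
    exists (a * d + c * b), (b * d); split.
    + by do ![apply: preconeD => //|apply: preconeM => //].
    + exact: preconeM.
    + by rewrite rmorphM mulf_neq0.
    + by rewrite addf_div // rmorphD !rmorphM.
  exists (a * c), (b * d); split; rewrite ?rmorphM ?mulf_neq0 ?mulf_div //;
    exact: preconeM.
- move=> _ [a [b [Ta Tb b0 ->]]]; rewrite invf_div.
  have [a0|a0] := eqVneq (phi a) 0; last by exists b, a.
  rewrite a0 invr0 mulr0 -(rmorph0 phi); apply: frac_cone_ext; exact: precone0.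
- move=> _ [a [b [Ta Tb b0 ->]]] [c [d [Tc Td d0]]] E1.
  have : phi (a * d + c * b) = 0.
    have : phi a / phi b + phi c / phi d = 0 by rewrite -E1 subrr.
    rewrite addf_div // -!rmorphM -rmorphD => /eqP.
    rewrite mulf_eq0 invr_eq0 rmorphM mulf_eq0 (negPf b0) (negPf d0) !orbF.
    by move/eqP.
  move=> /kerphi[_ sN].
  have sad : supp T (a * d).
    split; first exact: preconeM.
    rewrite (_ : - _ = - (a * d + c * b) + c * b); last by ring.
    by apply: preconeD => //; apply: preconeM.
  have /kerphi : supp T a.
    by have [//|/kerphi d1] := Tp _ _ sad; rewrite d1 eqxx in d0.
  by move=> ->; rewrite mul0r.
- move=> _ _ [a [b [Ta Tb b0 ->]]] [c [d [Tc Td d0 ->]]].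
  have aux u v w : phi w != 0 -> T w -> T (u - v) ->
     frac_cone (phi u / phi w - phi v / phi w).
    by move=> w0 Tw Tuv; exists (u - v), w; split; rewrite // -mulrBl rmorphB.
  have Tbd : T (b * d) by apply: preconeM.
  have bd0 : phi (b * d) != 0 by rewrite rmorphM mulf_neq0.
  have -> : phi a / phi b = phi (a * d) / phi (b * d).
    by rewrite !rmorphM -mulf_div divff // mulr1.
  have -> : phi c / phi d = phi (c * b) / phi (b * d).
    by rewrite [b * d]mulrC !rmorphM -mulf_div divff // mulr1.
  have [Tadbc|Tadbc] := Tt (a * d - c * b); [left|right]; apply: aux => //.
  by rewrite -opprB.
Qed.

End FracCone.

Lemma order_cone_preim (K E : fieldType) (i : {rmorphism K -> E}) (T : set E) :
  order_cone T -> order_cone [set x | T (i x)].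
Proof.
move=> [T1 [TD TM] TV Ta Tt]; split; rewrite /= ?rmorph1 //.
- by split=> x y; rewrite ?rmorphD ?rmorphM; [apply: TD|apply: TM].
- by move=> x; rewrite fmorphV; apply: TV.
- by move=> x; rewrite rmorphN => /Ta h /h /eqP; rewrite fmorph_eq0 => /eqP.
- by move=> x y; rewrite !rmorphB; apply: Tt.
Qed.

Lemma order_cone_image (K E : fieldType) (i : {rmorphism K -> E}) (T : set K) :
  order_cone T -> order_cone (i @` T).
Proof.
move=> [T1 [TD TM] TV Ta Tt]; split.
- by exists 1; rewrite ?rmorph1.
- split=> _ _ [x Tx <-] [y Ty <-].
    by exists (x + y); rewrite ?rmorphD //; apply: TD.
  by exists (x * y); rewrite ?rmorphM //; apply: TM.
- by move=> _ [x Tx <-]; exists x^-1; rewrite ?fmorphV //; apply: TV.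
- move=> _ [x Tx <-] [y Ty]; rewrite -rmorphN => /fmorph_inj yx.
  by rewrite yx in Ty; rewrite (Ta x) ?rmorph0.
- move=> _ _ [x Tx <-] [y Ty <-].
  by have [?|?] := Tt _ _ Tx Ty; [left; exists (x - y)|right; exists (y - x)];
    rewrite ?rmorphB.
Qed.

Lemma order_cone_bigcup (E : fieldType) (F : set (set E)) :
  (forall T, F T -> order_cone T) -> total_on F subset -> F !=set0 ->
  order_cone (\bigcup_(T in F) T).
Proof.
move=> hF Ftot [X FX].
have pair x y : (\bigcup_(T in F) T) x -> (\bigcup_(T in F) T) y ->
    exists T, [/\ F T, T x & T y].
  move=> [Y FY Yx] [Z FZ Zy]; have [YZ|ZY] := Ftot _ _ FY FZ.
    by exists Z; split=> //; apply: YZ.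
  by exists Y; split=> //; apply: ZY.
split.
- by exists X => //; have [] := hF _ FX.
- split=> x y Ux Uy; have [Y [FY Yx Yy]] := pair _ _ Ux Uy; exists Y => //;
    have [_ [YD YM] _ _ _] := hF _ FY; [exact: YD|exact: YM].
- move=> x [Y FY Yx]; exists Y => //; have [_ _ YV _ _] := hF _ FY.
  exact: YV.
- move=> x Ux Uy; have [Y [FY Yx Yy]] := pair _ _ Ux Uy.
  by have [_ _ _ Ya _] := hF _ FY; apply: Ya.
- move=> x y Ux Uy; have [Y [FY Yx Yy]] := pair _ _ Ux Uy.
  have [_ _ _ _ Yt] := hF _ FY.
  by have [?|?] := Yt _ _ Yx Yy; [left|right]; exists Y.
Qed.

Section ConeField.
Variables (E : fieldType) (T : set E) (hT : order_cone T).

Record cone_field := ConeField {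
  cone_field_val : E;
  cone_field_valP : cone_field_val \in cone_field_pred T }.

HB.instance Definition _ := [isSub for cone_field_val].
HB.instance Definition _ := [Choice of cone_field by <:].
HB.instance Definition _ := GRing.isDivringClosed.Build E (cone_field_pred T)
  (cone_field_closed hT).
HB.instance Definition _ := [SubChoice_isSubIntegralDomain of cone_field by <:].
HB.instance Definition _ := [SubIntegralDomain_isSubField of cone_field by <:].

Implicit Types x y : cone_field.

Definition cone_le x y := `[< T (val y - val x) >].
Definition cone_norm x := if cone_le 0 x then x else - x.

Lemma cone_le0 x : cone_le 0 x = `[< T (val x) >].
Proof. by rewrite /cone_le rmorph0 subr0. Qed.

Lemma cone_lex0 x : cone_le x 0 = `[< T (- val x) >].
Proof. by rewrite /cone_le rmorph0 sub0r. Qed.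

Lemma cone_le0_add x y : cone_le 0 x -> cone_le 0 y -> cone_le 0 (x + y).
Proof.
have [_ [TD _] _ _ _] := hT; rewrite !cone_le0 rmorphD.
by move=> /asboolP ? /asboolP ?; apply/asboolP/TD.
Qed.

Lemma cone_le0_mul x y : cone_le 0 x -> cone_le 0 y -> cone_le 0 (x * y).
Proof.
have [_ [_ TM] _ _ _] := hT; rewrite !cone_le0 rmorphM.
by move=> /asboolP ? /asboolP ?; apply/asboolP/TM.
Qed.

Lemma cone_le0_anti x : cone_le 0 x -> cone_le x 0 -> x = 0.
Proof.
have [_ _ _ Ta _] := hT; rewrite cone_le0 cone_lex0.
by move=> /asboolP ? /asboolP ?; apply: val_inj; rewrite rmorph0; apply: Ta.
Qed.

Lemma cone_sub_ge0 x y : cone_le 0 (y - x) = cone_le x y.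
Proof. by rewrite cone_le0 rmorphB. Qed.

Lemma cone_le0_total x : cone_le 0 x || cone_le x 0.
Proof.
rewrite cone_le0 cone_lex0; have /asboolP := cone_field_valP x.
by case=> ?; apply/orP; [left|right]; apply/asboolP.
Qed.

Lemma cone_ge0_norm x : cone_le 0 x -> cone_norm x = x.
Proof. by rewrite /cone_norm => ->. Qed.

Lemma cone_normN x : cone_norm (- x) = cone_norm x.
Proof.
have le0N y : cone_le 0 (- y) = cone_le y 0.
  by rewrite cone_le0 cone_lex0 rmorphN.
rewrite /cone_norm le0N opprK.
case: ifP => x1; case: ifP => x2 //.
  by rewrite (cone_le0_anti x2 x1) oppr0.
by have := cone_le0_total x; rewrite x1 x2.
Qed.

HB.instance Definition _ := Num.IntegralDomain_isLeReal.Build cone_field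
  cone_le0_add cone_le0_mul cone_le0_anti cone_sub_ge0 cone_le0_total
  cone_normN cone_ge0_norm (fun _ _ => erefl).

Lemma real_field_of_cone : exists (F : realFieldType) (i : {rmorphism F -> E}),
  (forall x : F, 0 <= x <-> T (i x)) /\
  forall y : E, T y \/ T (- y) -> exists x : F, i x = y.
Proof.
pose i : {rmorphism cone_field -> E} := val.
have leP x : 0 <= x <-> T (i x).
  by rewrite -[0 <= x]/(cone_le 0 x) cone_le0; split => /asboolP.
exists cone_field, i; split; first exact: leP.
by move=> y Ty; exists (ConeField (introT (asboolP _) Ty)).
Qed.

End ConeField.

Section CountableSubfield.
Variables (E : fieldType) (e : seq E).

Fixpoint code_val (t : GenTree.tree nat) : E :=
  match t with
  | GenTree.Leaf i => e`_i
  | GenTree.Node 0 [:: u; v] => code_val u - code_val v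
  | GenTree.Node 1 [:: u; v] => code_val u / code_val v
  | _ => 1
  end.

Definition gen_pred : pred E := fun x => `[< exists t, code_val t = x >].

Lemma gen_closed : divring_closed gen_pred.
Proof.
split.
- by apply/asboolP; exists (GenTree.Node 2 [::]).
- move=> x y /asboolP[u <-] /asboolP[v <-]; apply/asboolP.
  by exists (GenTree.Node 0 [:: u; v]).
- move=> x y /asboolP[u <-] /asboolP[v <-]; apply/asboolP.
  by exists (GenTree.Node 1 [:: u; v]).
Qed.

Record gen_field := GenField {
  gen_field_val : E;
  gen_field_valP : gen_field_val \in gen_pred }.

Definition gen_code (x : gen_field) : GenTree.tree nat :=
  projT1 (cid (asboolW (gen_field_valP x))).

HB.instance Definition _ := [isSub for gen_field_val].
HB.instance Definition _ := [Choice of gen_field by <:].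

Lemma gen_codeK : pcancel gen_code (fun t => insub (code_val t)).
Proof.
by move=> x; rewrite /gen_code; case: cid => t /= ->; rewrite valK.
Qed.

HB.instance Definition _ := Countable.copy gen_field (pcan_type gen_codeK).
HB.instance Definition _ := GRing.isDivringClosed.Build E gen_pred gen_closed.
HB.instance Definition _ := [SubChoice_isSubIntegralDomain of gen_field by <:].
HB.instance Definition _ := [SubIntegralDomain_isSubField of gen_field by <:].

Lemma countable_subfield : exists (K : countFieldType) (i : {rmorphism K -> E}),
  forall x, x \in e -> exists y, i y = x.
Proof.
pose i : {rmorphism gen_field -> E} := val.
exists gen_field, i => x xe.
have xP : x \in gen_pred.
  by apply/asboolP; exists (GenTree.Leaf (index x e)); rewrite /= nth_index.
by exists (GenField xP).
Qed.

End CountableSubfield.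

(** * Real closure *)

Section SignChange.
Variable F : realFieldType.
Implicit Types (f g s : {poly F}) (l : seq (F * {poly F})).

Definition weighted_sos l : {poly F} := \sum_(x <- l) x.1 *: x.2 ^+ 2.

Definition nneg_weights l := all (fun x => 0 <= x.1) l.

Lemma weighted_sos_ge0 l a : nneg_weights l -> 0 <= (weighted_sos l).[a].
Proof.
move=> /allP hl; rewrite horner_sum big_seq sumr_ge0 // => x /hl x0.
by rewrite hornerZ horner_exp mulr_ge0 ?sqr_ge0.
Qed.

(* Once the squares are reduced modulo [f], the cofactor of [f] in
   [1 + weighted_sos l] has degree at most [deg f - 2] and changes sign
   wherever [f] does. *)
Lemma sign_change_ndvd f a b l : f.[a] * f.[b] < 0 -> nneg_weights l ->
  ~~ (f %| 1 + weighted_sos l).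
Proof.
elim: {f}(size f) {-2}f (leqnn (size f)) l => [|n ih] f szf l fab hl.
  move: fab; rewrite (eqP (_ : f == 0)) ?horner0 ?mul0r ?ltxx //.
  by rewrite -size_poly_leq0.
apply/negP => fl.
pose l' := [seq (x.1, x.2 %% f) | x <- l].
have hl' : nneg_weights l' by rewrite /nneg_weights all_map.
have f1 : (1 < size f)%N.
  rewrite ltnNge; apply/negP => /size1_polyC fC; move: fab; rewrite fC !hornerC.
  by rewrite -expr2 ltNge sqr_ge0.
have f0 : f != 0 by rewrite -size_poly_gt0 ltnW.
have fl' : f %| 1 + weighted_sos l'.
  have -> : 1 + weighted_sos l' =
      (1 + weighted_sos l) - (weighted_sos l - weighted_sos l') by ring.
  rewrite dvdp_sub // /weighted_sos big_map -sumrB.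
  apply: (big_ind (fun p => f %| p)) => [||x _].
  - exact: dvdp0.
  - exact: dvdp_add.
  rewrite /= -scalerBr -mul_polyC dvdp_mull // subr_sqr dvdp_mulr //.
  by rewrite {1}(divp_eq x.2 f) addrK dvdp_mull.
have [q Eq] : exists q : {poly F}, 1 + weighted_sos l' = q * f by apply/dvdpP.
have pos c : 0 < q.[c] * f.[c].
  by rewrite -hornerM -Eq hornerD hornerC ltr_pwDl // weighted_sos_ge0.
have q0 : q != 0.
  by apply: contraTneq (pos 0) => ->; rewrite horner0 mul0r ltxx.
have szq : (size q < size f)%N.
  have : (size (q * f)%R <= (size f).-1.*2.-1)%N.
    rewrite -Eq (leq_trans (size_polyD _ _)) // geq_max size_poly1.
    apply/andP; split; first by move: f1; lia.
    rewrite /weighted_sos big_map.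
    apply: (big_ind (fun p : {poly F} => (size p <= (size f).-1.*2.-1)%N))
        => [|p1 p2 h1 h2|x _].
    - by rewrite size_poly0.
    - by rewrite (leq_trans (size_polyD _ _)) // geq_max h1.
    rewrite (leq_trans (size_scale_leq _ _)) //= expr2.
    have := ltn_modp x.2 f; rewrite f0 => szm.
    rewrite (leq_trans (size_polyMleq _ _)) //; move: szm f1.
    by move: (size _) => u; move: (size f) => v; lia.
  by rewrite size_mul //; move: f1; move: (size q) (size f) => u v; lia.
have qab : q.[a] * q.[b] < 0.
  have := mulr_gt0 (pos a) (pos b).
  by rewrite mulrACA mulrC nmulr_rgt0.
have /negP := ih q (leq_trans szq szf) l' qab hl'; apply.
by rewrite Eq dvdp_mulr.
Qed.

Lemma sign_change_prime_cone f a b : f.[a] * f.[b] < 0 ->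
  exists T : set {poly F}, [/\ prime_cone T, supp T f &
    forall c, 0 <= c -> T c%:P].
Proof.
move=> fab.
pose T0 : set {poly F} :=
  [set p | exists l g, nneg_weights l /\ p = weighted_sos l + f * g].
have T0_cst c : 0 <= c -> T0 c%:P.
  move=> c0; exists [:: (c, 1)], 0; rewrite /nneg_weights /= c0; split=> //.
  by rewrite /weighted_sos big_seq1 /= expr1n mulr0 addr0 alg_polyC.
have pT0 : precone T0.
  split.
  - move=> _ _ [l [g [hl ->]]] [l' [g' [hl' ->]]].
    exists (l ++ l'), (g + g'); rewrite /nneg_weights all_cat.
    split; first by apply/andP.
    have -> : weighted_sos (l ++ l') = weighted_sos l + weighted_sos l'.
      by rewrite /weighted_sos big_cat.
    by ring.
  - move=> _ _ [l [g [hl ->]]] [l' [g' [hl' ->]]].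
    exists [seq (x.1 * y.1, x.2 * y.2) | x <- l, y <- l'],
      (weighted_sos l * g' + weighted_sos l' * g + f * g * g'); split.
      apply/allP => _ /allpairsP[[x y] /= [xl yl ->]] /=.
      by apply: mulr_ge0; [exact: (allP hl _ xl)|exact: (allP hl' _ yl)].
    have -> : weighted_sos [seq (x.1 * y.1, x.2 * y.2) | x <- l, y <- l'] =
        weighted_sos l * weighted_sos l'.
      rewrite /weighted_sos big_allpairs_dep mulr_suml; apply: eq_bigr => x _.
      rewrite mulr_sumr; apply: eq_bigr => y _ /=.
      by rewrite exprMn -scalerAl -scalerAr scalerA.
    by ring.
  - move=> p; exists [:: (1, p)], 0; rewrite /nneg_weights /= ler01; split=> //.
    by rewrite /weighted_sos big_seq1 /= scale1r mulr0 addr0.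
have [k|T [T0T pT _]] := prime_cone_exists (q := 1) pT0.
  rewrite !expr1n => -[l [g [hl E]]].
  have /negP := sign_change_ndvd fab hl; apply.
  have -> : 1 + weighted_sos l = f * (- g).
    by rewrite mulrN -[weighted_sos l](addrK (f * g)) -E; ring.
  exact: dvdp_mulr.
exists T; split=> //; last by move=> c /T0_cst /T0T.
split; apply: T0T; [exists [::], 1|exists [::], (- 1)];
  by rewrite /weighted_sos big_nil add0r ?mulrN mulr1.
Qed.

Lemma sign_change_ivt :
  (forall f a b, f.[a] * f.[b] < 0 -> exists r, root f r) ->
  Num.real_closed_axiom F.
Proof.
move=> hroot f.
elim: {f}(size f) {-2}f (leqnn (size f)) => [|n ih] f szf a b ab.
  move=> _; exists a; first by rewrite lexx.
  by rewrite (eqP (_ : f == 0)) ?root0 // -size_poly_leq0.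
move=> /andP[]; rewrite le_eqVlt => /orP[/eqP fa _|fa].
  by exists a; rewrite ?lexx //; apply/eqP.
rewrite le_eqVlt => /orP[/eqP fb|fb].
  by exists b; rewrite ?lexx ?ab //; apply/eqP.
have [|r fr] := hroot f a b; first by rewrite nmulr_rlt0.
have [arb|] := boolP (a <= r <= b); first by exists r.
have /factor_theorem[q Eq] := fr.
have q0 : q != 0.
  by apply: contraTneq fa => q0; rewrite Eq q0 mul0r horner0 ltxx.
have szq : (size q <= n)%N.
  by move: szf; rewrite Eq size_Mmonic ?monicXsubC // size_XsubC addn2.
have Er p : root p =1 root q -> (exists2 x, a <= x <= b & root p x) ->
    exists2 x, a <= x <= b & root f x.
  by move=> pq [x xab]; rewrite pq => qx; exists x; rewrite // Eq rootM qx.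
rewrite Eq !hornerM !hornerXsubC in fa fb.
rewrite negb_and -!ltNge => /orP[ra|br].
  apply: (Er q) => //; apply: ih => //.
  rewrite -(pmulr_lle0 _ (x := a - r)) ?subr_gt0 // (ltW fa) /=.
  by rewrite -(pmulr_lge0 _ (x := b - r)) ?subr_gt0 ?(lt_le_trans ra) // ltW.
apply: (Er (- q)) => [x|]; first by rewrite rootN.
apply: ih; rewrite ?size_polyN // !hornerN oppr_le0 oppr_ge0.
rewrite -(nmulr_lle0 _ (x := a - r)) ?subr_lt0 ?(le_lt_trans ab) // (ltW fa) /=.
by rewrite -(nmulr_lge0 _ (x := b - r)) ?subr_lt0 // ltW.
Qed.

End SignChange.

Section PrimeConeRoot.
Variables (F : realFieldType) (C : closedFieldType) (i : {rmorphism F -> C}).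
Implicit Types (f p : {poly F}).

Lemma prime_cone_root (T : set {poly F}) f :
  prime_cone T -> supp T f -> f != 0 ->
  exists r, forall p, (map_poly i p).[r] = 0 <-> supp T p.
Proof.
move=> hT sf f0; have [pT _ T1 Tp] := hT.
have suppC p : supp T p -> (size p <= 1)%N -> p = 0.
  move=> sp /size1_polyC pC; have [//|p0] := eqVneq p 0; case: T1.
  have [_] : supp T 1.
    rewrite (_ : 1 = (p`_0)^-1%:P * p); first exact: suppM.
    by rewrite [X in _ * X]pC -polyCM mulVf // -polyC_eq0 -pC.
  by [].
pose P k := `[< exists m, [/\ supp T m, m != 0 & size m = k] >].
have exP : exists k, P k by exists (size f); apply/asboolP; exists f.
have [k /asboolP[m [sm m0 szm]] kmin] := ex_minnP exP.
have m1 : (1 < size m)%N.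
  by rewrite ltnNge; apply: contra m0 => /(suppC _ sm)/eqP.
have mP p : supp T p -> m %| p.
  move=> sp; apply/modp_eq0P/eqP; apply: contraTT isT => pm0.
  have : (k <= size (p %% m)%R)%N.
    apply: kmin; apply/asboolP; exists (p %% m); split=> //.
    rewrite (_ : p %% m = p + - ((p %/ m) * m)).
      by apply: suppD => //; apply: suppN; apply: suppM.
    by rewrite {2}(divp_eq p m); ring.
  by rewrite -szm leqNgt ltn_modp m0.
have [r mr] : exists r, root (map_poly i m) r.
  by apply/closed_rootP; rewrite size_map_poly neq_ltn m1 orbT.
exists r => p; split=> [/eqP pr|/mP/dvdpP[q ->]]; last first.
  by rewrite rmorphM hornerM (rootP mr) mulr0.
have gr : root (map_poly i (gcdp p m)) r.
  by rewrite gcdp_map root_gcd; apply/andP.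
have /dvdpP[q Eq] := dvdp_gcdr p m.
have [sg|sq] : supp T (gcdp p m) \/ supp T q.
- by apply: Tp; rewrite mulrC -Eq.
- by have /dvdpP[u ->] := dvdp_gcdl p m; apply: suppM.
have q0 : q != 0 by apply: contraNneq m0 => q0; rewrite Eq q0 mul0r.
have g0 : gcdp p m != 0 by rewrite gcdp_eq0 negb_and m0 orbT.
have szg : (1 < size (gcdp p m))%N.
  by rewrite -(size_map_poly i) (root_size_gt1 _ gr) ?map_poly_eq0.
have szq : (0 < size q)%N by rewrite size_poly_gt0.
have := dvdp_leq q0 (mP _ sq); rewrite {1}Eq size_mul // => szqg.
by exfalso; move: (size q) (size (gcdp p m)) szq szg szqg => u v; lia.
Qed.

End PrimeConeRoot.

Lemma rcf_of_order_cone (C : closedFieldType) (T0 : set C) : order_cone T0 ->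
  exists (F : rcfType) (i : {rmorphism F -> C}),
    forall y, T0 y -> exists2 x, 0 <= x & i x = y.
Proof.
move=> hT0.
have [|G GP Gtot [X GX]|T [[hT T0T] maxT]] := @Zorn_nonempty_chains C
    [set T | order_cone T /\ T0 `<=` T] T0; first by split.
  split; last by move=> y T0y; exists X => //; have [_] := GP _ GX; apply.
  by apply: order_cone_bigcup => //; [move=> Y /GP[]|exists X].
have [F [i [iP iT]]] := real_field_of_cone hT.
have iT' y : T y -> exists2 x, 0 <= x & i x = y.
  move=> Ty; have [x ix] : exists x, i x = y by apply: iT; left.
  by exists x => //; apply/iP; rewrite ix.
suff ivt : Num.real_closed_axiom F.
  pose H := Num.RealField_isClosed.Build F ivt.
  pose Frcf : rcfType := HB.pack F H.
  by exists Frcf, i => y /T0T /iT'.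
apply: sign_change_ivt => f a b fab.
have [A [hA sf Ac]] := sign_change_prime_cone fab.
have f0 : f != 0 by apply: contraTneq fab => ->; rewrite horner0 mul0r ltxx.
have [r rP] := prime_cone_root i hA sf f0.
pose phi : {rmorphism {poly F} -> C} := (horner_eval r \o map_poly i)%FUN.
have phiP p : phi p = 0 <-> supp A p by rewrite -rP.
have phiC x : phi x%:P = i x.
  by rewrite /phi /= /horner_eval map_polyC hornerC.
have TA : T = frac_cone phi A.
  symmetry; apply: maxT; last split.
  - move=> y /iT'[x x0 <-].
    by rewrite -phiC; apply: frac_cone_ext => //; apply: Ac.
  - exact: frac_cone_order.
  - move=> y /T0T/iT'[x x0 <-].
    by rewrite -phiC; apply: frac_cone_ext => //; apply: Ac.
have [x ix] : exists x, i x = r.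
  have phiX : phi 'X = r by rewrite /phi /= /horner_eval map_polyX hornerX.
  have [_ At _ _] := hA.
  apply: iT; rewrite TA -phiX -rmorphN.
  by case: (At 'X) => AX; [left|right]; apply: frac_cone_ext.
exists x; rewrite -(fmorph_root i) ix; apply/eqP/rP.
exact: sf.
Qed.

(** * From prime cones to real points *)

Section IntegerTerms.

Fixpoint zeval (B : comNzRingType) (e : seq B) (t : term int) : B :=
  match t with
  | Var i => e`_i
  | Const z => z%:~R
  | NatConst n => n%:R
  | Add u v => zeval e u + zeval e v
  | Opp u => - zeval e u
  | NatMul u n => zeval e u *+ n
  | Mul u v => zeval e u * zeval e v
  | Exp u n => zeval e u ^+ n
  end.

Lemma zeval_rmorph (B B' : comNzRingType) (phi : {rmorphism B -> B'}) e t :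
  phi (zeval e t) = zeval (map phi e) t.
Proof.
elim: t => /= [i|z|n|u <- v <-|u <-|u <- n|u <- v <-|u <- n].
- have [lti|lei] := ltnP i (size e); first by rewrite (nth_map 0).
  by rewrite !nth_default ?size_map // rmorph0.
- exact: rmorph_int.
- exact: rmorph_nat.
- exact: rmorphD.
- exact: rmorphN.
- exact: rmorphMn.
- exact: rmorphM.
- exact: rmorphXn.
Qed.

Fixpoint rat_term (t : term int) : term rat :=
  match t with
  | Var i => Var _ i
  | Const z => Const z%:~R
  | NatConst n => NatConst _ n
  | Add u v => Add (rat_term u) (rat_term v)
  | Opp u => Opp (rat_term u)
  | NatMul u n => NatMul (rat_term u) n
  | Mul u v => Mul (rat_term u) (rat_term v)
  | Exp u n => Exp (rat_term u) n
  end.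

Lemma reval_rat_term (F : rcfType) (e : seq F) t :
  reval e (rat_term t) = zeval e t.
Proof.
rewrite /reval; elim: t => //= [z|u -> v ->|u ->|u -> n|u -> v ->|u -> n] //.
exact: ratr_int.
Qed.

Lemma clear_denominators (t : term rat) :
  exists (d : nat) (s : term int), (0 < d)%N /\
    forall (F : rcfType) (e : seq F), zeval e s = reval e t *+ d.
Proof.
rewrite /reval.
elim: t => [i|q|n|u [d [s [d0 E]]] v [d' [s' [d'0 E']]]|u [d [s [d0 E]]]
    |u [d [s [d0 E]]] n|u [d [s [d0 E]]] v [d' [s' [d'0 E']]]
    |u [d [s [d0 E]]] n].
- by exists 1, (Var _ i).
- exists `|denq q|%N, (Const (numq q)); split.
    by rewrite absz_gt0 denq_neq0.
  move=> F e /=; rewrite pmulrn absz_denq -[RHS]mulrzr.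
  by rewrite /ratr divfK // intr_eq0 denq_neq0.
- by exists 1, (NatConst _ n).
- exists (d * d')%N, (Add (NatMul s d') (NatMul s' d)); split.
    by rewrite muln_gt0 d0.
  by move=> F e /=; rewrite E E' -!mulrnA [(d' * d)%N]mulnC mulrnDl.
- by exists d, (Opp s); split=> // F e /=; rewrite E mulNrn.
- by exists d, (NatMul s n); split=> // F e /=; rewrite E mulrnAC.
- exists (d * d')%N, (Mul s s'); split; first by rewrite muln_gt0 d0.
  by move=> F e /=; rewrite E E' mulrnAl mulrnAr -mulrnA mulnC.
- exists (d ^ n)%N, (Exp s n); split; first by rewrite expn_gt0 d0.
  by move=> F e /=; rewrite E exprMn_n.
Qed.

End IntegerTerms.

Lemma rcf_of_prime_cone (B : comNzRingType) (T : set B) (e : seq B) :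
  prime_cone T -> exists (F : rcfType) (c : B -> F),
  forall s, {subset s <= e} ->
  forall t, 0 <= zeval (map c s) t <-> T (zeval s t).
Proof.
move=> hT; have [pT Tt _ _] := hT.
have [E [phi phiP]] := residue_field hT.
have TE := frac_cone_order hT phiP.
have [K [j jP]] := countable_subfield (map phi e).
have [C [iota _]] := countable_algebraic_closure K.
have TC := order_cone_image iota (order_cone_preim j TE).
have [F [i iP]] := rcf_of_order_cone TC.
have /choice[y yP] b : exists y, b \in e -> j y = phi b.
  by have [/(map_f phi)/jP[y jy]|] := boolP (b \in e); [exists y|exists 0].
have lift z x : T z -> j x = phi z -> exists2 u, 0 <= u & i u = iota x.
  move=> Tz jx; apply: iP; exists x => //=; rewrite jx.
  exact: frac_cone_ext.
have /choice[c cP] b : exists x, b \in e -> i x = iota (y b).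
  have [be|] := boolP (b \in e); last by exists 0.
  have [Tb|Tb] := Tt b.
    by have [u _ iu] := lift _ _ Tb (yP _ be); exists u.
  have [|u _ iu] := lift _ (- y b) Tb; first by rewrite !rmorphN yP.
  by exists (- u); rewrite rmorphN iu rmorphN opprK.
exists F, c => s se t.
have Ei : i (zeval (map c s) t) = iota (zeval (map y s) t).
  rewrite !zeval_rmorph -!map_comp; congr zeval.
  by apply/eq_in_map => b /se /cP.
have Ej : j (zeval (map y s) t) = phi (zeval s t).
  rewrite !zeval_rmorph -!map_comp; congr zeval.
  by apply/eq_in_map => b /se /yP.
have pos x z v : i x = iota v -> j v = phi z -> T z -> 0 <= x.
  move=> ix jv Tz; have [u u0 iu] := lift _ _ Tz jv.
  by rewrite (_ : x = u) //; apply: (fmorph_inj i); rewrite iu.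
split; last exact: pos Ei Ej.
move=> x0; have [//|TN] := Tt (zeval s t).
have : 0 <= - zeval (map c s) t.
  apply: (pos _ (- zeval s t) (- zeval (map y s) t)) => //.
    by rewrite !rmorphN Ei.
  by rewrite !rmorphN Ej.
rewrite oppr_ge0 => x0'; have x00 : zeval (map c s) t = 0.
  by apply/eqP; rewrite eq_le x0 x0'.
have y0 : zeval (map y s) t = 0.
  by apply: (fmorph_inj iota); rewrite -Ei x00 !rmorph0.
by have /phiP[] : phi (zeval s t) = 0; rewrite // -Ej y0 rmorph0.
Qed.

Section MpolyTerm.
Variables (R : comNzRingType) (n : nat).

Lemma mpoly_term (cs : seq R) (P : mpoly n R) :
  {subset [seq mcoeff m P | m <- msupp P] <= cs} ->
  exists t : term int, forall (B : comNzRingType) (g : {rmorphism R -> B})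
    (x : seq B), zeval (map g cs ++ x) t = mmap g (fun i => x`_i) P.
Proof.
move=> Pcs; rewrite /mmap.
have : forall m, m \in msupp P -> mcoeff m P \in cs.
  by move=> m mP; apply/Pcs/map_f.
elim: (msupp P) => [|m s ih] hs.
  by exists (NatConst _ 0) => B g x; rewrite big_nil.
have [|t tP] := ih; first by move=> m' m's; apply: hs; rewrite inE m's orbT.
have [u uP] : exists u : term int, forall (B : comNzRingType) (y x : seq B),
    size y = size cs ->
    zeval (y ++ x) u = \prod_(i < n) x`_i ^+ m i.
  rewrite unlock; elim: (index_enum _) => [|i r [u uP]].
    by exists (NatConst _ 1).
  exists (Mul (Exp (Var _ (size cs + i)) (m i)) u) => B y x szy /=.
  by rewrite uP // nth_cat szy ltnNge leq_addr addKn.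
exists (Add (Mul (Var _ (index (mcoeff m P) cs)) u) t) => B g x /=.
rewrite big_cons tP uP ?size_map //; congr (_ * _ + _).
have ics : (index (mcoeff m P) cs < size cs)%N.
  by rewrite index_mem; apply: hs; rewrite inE eqxx.
by rewrite nth_cat size_map ics (nth_map 0) // nth_index // -index_mem.
Qed.

End MpolyTerm.

Section RealPoints.
Variables (R : realType) (n : nat).
Implicit Types (P Q : mpoly n R) (T : set (mpoly n R)).

Lemma prime_cone_cst T (r : R) : prime_cone T -> T (mpolyC n r) <-> 0 <= r.
Proof.
move=> [pT _ T1 _]; have pos (s : R) : 0 <= s -> T (mpolyC n s).
  by move=> s0; rewrite -(sqr_sqrtr s0) rmorphXn; apply: precone_sqr.
split; last exact: pos.
move=> Tr; rewrite leNgt; apply/negP => r0; apply: T1.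
rewrite (_ : -1 = mpolyC n r * mpolyC n (- r^-1)).
  by apply: preconeM => //; apply: pos; rewrite oppr_ge0 invr_le0 ltW.
by rewrite -rmorphM mulrN divff ?lt_eqF // rmorphN1.
Qed.

Lemma prime_cone_point T P Q : prime_cone T -> supp T P -> ~ supp T Q ->
  exists x : 'rV[R]_n, peval P x = 0 /\ peval Q x != 0.
Proof.
move=> hT sP nsQ.
pose cs := [seq mcoeff m P | m <- msupp P] ++ [seq mcoeff m Q | m <- msupp Q].
pose C : {rmorphism R -> mpoly n R} := @mpolyC n R.
pose X : seq (mpoly n R) := [seq mpolyX R (mnm1 i) | i <- enum 'I_n].
have szX : size X = n by rewrite size_map size_enum_ord.
have [tP tPE] : exists t : term int, forall (B : comNzRingType)
    (g : {rmorphism R -> B}) (x : seq B),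
    zeval (map g cs ++ x) t = mmap g (fun i => x`_i) P.
  by apply: mpoly_term => c; rewrite mem_cat => ->.
have [tQ tQE] : exists t : term int, forall (B : comNzRingType)
    (g : {rmorphism R -> B}) (x : seq B),
    zeval (map g cs ++ x) t = mmap g (fun i => x`_i) Q.
  by apply: mpoly_term => c; rewrite mem_cat orbC => ->.
have mmapX p : mmap C (fun i => X`_i) p = p.
  rewrite [RHS]mpolyE /mmap; apply: eq_bigr => m _.
  rewrite -mul_mpolyC -mmap1_id; congr (_ * _); apply: mmap1_eq => i.
  by rewrite (nth_map i) ?size_enum_ord // nth_ord_enum.
have [F [c cP]] := rcf_of_prime_cone (map C cs ++ X) hT.
have cX t : 0 <= zeval (map c (map C cs) ++ map c X) t <->
    T (zeval (map C cs ++ X) t).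
  by rewrite -map_cat; apply: cP.
have ccs t : 0 <= zeval (map c (map C cs)) t <-> 0 <= zeval cs t.
  rewrite -(prime_cone_cst _ hT) -[mpolyC n _]/(C _) zeval_rmorph; apply: cP.
  by move=> b; rewrite mem_cat => ->.
have eq0 t : zeval (map c (map C cs) ++ map c X) t = 0 <->
    supp T (zeval (map C cs ++ X) t).
  have := cX t; have := cX (Opp t); rewrite /= oppr_ge0 => -[N1 N2] [P1 P2].
  split=> [z0|[/P2 p /N2 m]]; last by apply/eqP; rewrite eq_le p m.
  by split; [apply: P1|apply: N1]; rewrite z0.
pose f : formula rat :=
  And (Equal (rat_term tP) (NatConst _ 0))
      (Not (Equal (rat_term tQ) (NatConst _ 0))).
have fE (K : rcfType) (e : seq K) :
    rholds e f = (zeval e tP == 0) && (zeval e tQ != 0).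
  by rewrite -!reval_rat_term.
have [|t||x' szx'] := @rcf_transfer F R (map c (map C cs)) cs _ _ f (map c X).
- by rewrite !size_map.
- have [d [s [d0 sE]]] := clear_denominators t.
  rewrite -(pmulrn_lge0 _ d0) -[in RHS](pmulrn_lge0 _ d0) -!sE.
  by apply/idP/idP => /ccs.
- rewrite fE; apply/andP; split.
    by apply/eqP/eq0; rewrite tPE mmapX.
  by apply/eqP => /eq0; rewrite tQE mmapX.
rewrite size_map szX in szx'.
rewrite fE => /andP[/eqP P0 Q0]; exists (\row_i x'`_i).
have pE (p : mpoly n R) t : (forall (B : comNzRingType)
    (g : {rmorphism R -> B}) (x : seq B),
    zeval (map g cs ++ x) t = mmap g (fun i => x`_i) p) ->
  peval p (\row_i x'`_i) = zeval (cs ++ x') t.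
  move=> tE; have := tE R idfun x'; rewrite map_id => ->.
  by rewrite /peval /meval /mmap; apply: eq_bigr => m _; congr (_ * _);
    apply: mmap1_eq => i; rewrite mxE.
by rewrite (pE _ _ tPE) (pE _ _ tQE).
Qed.

Lemma positive_definite_kernel (L : {scalar mpoly n R}) P Q :
  positive_definite L -> L (P ^+ 2) = 0 -> L (P * Q) = 0.
Proof.
move=> Lpos LP; apply/eqP; apply: contraT => LPQ.
pose t := - (L (Q ^+ 2) + 1) / (L (P * Q) *+ 2).
have := Lpos (t *: P + Q).
have -> : (t *: P + Q) ^+ 2 = t ^+ 2 *: P ^+ 2 + (t *+ 2) *: (P * Q) + Q ^+ 2.
  by rewrite sqrrD exprZn -scalerAl scalerMnl.
rewrite !linearD !linearZ /= LP mulr0 add0r.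
have -> : (t *+ 2) * L (P * Q) = - (L (Q ^+ 2) + 1) by rewrite /t; field.
by rewrite opprD addrAC addNr add0r oppr_ge0 leNgt ltr01.
Qed.

Lemma positive_definite_vanishing (L : {scalar mpoly n R}) P :
  positive_definite L -> vanishes_on L (principal_ideal P) ->
  vanishes_on L (vanishing_ideal (zero_set P)).
Proof.
move=> Lpos LP Q Q0; apply: contrapT => LQ.
pose sos (l : seq (mpoly n R)) := \sum_(x <- l) x ^+ 2.
pose T0 : set (mpoly n R) := [set p | exists l S, p = sos l + S * P].
have LT0 p : T0 p -> 0 <= L p.
  move=> [l [S ->]]; rewrite linearD /= [L (S * P)]LP ?addr0; last by exists S.
  by rewrite linear_sum sumr_ge0.
have pT0 : precone T0.
  split=> [_ _ [l [S ->]] [l' [S' ->]]|_ _ [l [S ->]] [l' [S' ->]]|p].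
  - exists (l ++ l'), (S + S').
    have -> : sos (l ++ l') = sos l + sos l' by rewrite /sos big_cat.
    by ring.
  - exists [seq x * y | x <- l, y <- l'],
      (sos l * S' + S * sos l' + S * S' * P).
    have -> : sos [seq x * y | x <- l, y <- l'] = sos l * sos l'.
      rewrite /sos big_allpairs_dep mulr_suml; apply: eq_bigr => x _.
      by rewrite mulr_sumr; apply: eq_bigr => y _; rewrite exprMn.
    by ring.
  - by exists [:: p], 0; rewrite /sos big_seq1 mul0r addr0.
have [k T0Q|T [T0T hT nsQ]] := prime_cone_exists (q := Q) pT0.
  apply: LQ.
  have LQk : L ((Q ^+ k) ^+ 2) = 0.
    apply/eqP; rewrite eq_le Lpos andbT -oppr_ge0 -linearN exprAC.
    exact: LT0.
  have LQ2 : L (Q ^+ (2 ^ k)) = 0.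
    rewrite -(subnKC (ltnW (ltn_expl k (ltnSn 1)))) exprD.
    exact: positive_definite_kernel.
  elim: (k) LQ2 => [|m ih] LQ2; first by rewrite expn0 expr1 in LQ2.
  apply: ih; rewrite -[X in L X]mulr1; apply: positive_definite_kernel => //.
  by rewrite -exprM -expnSr.
have sP : supp T P.
  split; apply: T0T; [exists [::], 1|exists [::], (- 1)];
    by rewrite /sos big_nil add0r ?mulNr mul1r.
have [x [Px Qx]] := prime_cone_point hT sP nsQ.
by rewrite Q0 ?eqxx in Qx.
Qed.

End RealPoints.

Theorem theorem3p2 (R : realType) (n : nat) (hn : (1 <= n)%N)
    (V : set 'rV[R]_n) (hV : algebraic_set V) :
  set_type_A V <-> set_type_B V.
Proof.
split=> VT P VP L Lpos Lvan; apply: (VT P VP L Lpos).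
  move=> _ [S ->]; apply: Lvan => x Px.
  by rewrite /peval mevalM [X in _ * X]Px mulr0.
exact: positive_definite_vanishing.
Qed.
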